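(* For fixed positive integers $r$ and $d$ we have $$N(d,t,r) = rt + o(t)\qquad\text{as } t\to\infty,$$ that is, $\lim_{t\to\infty} \frac{N(d,t,r)-rt}{t}=0$.
   Context: For integers $d,r\ge 1$ and $t\ge 0$, $N(d,t,r)$ denotes the minimal positive integer $N$ such that every finite set $X\subset\mathbb{R}^d$ with at least $N$ points can be partitioned into $r$ pairwise disjoint sets $A_1,\dots,A_r$ such that $\bigcap_{i=1}^r \operatorname{conv}(A_i\setminus Y)\neq\emptyset$ for every $Y\subset X$ with at most $t$ points. (Such an $N$ is known to exist; e.g. $N(d,t,r)\le (r-1)(t+1)(d+1)+1$ for $r\ge 2$.) *)

(* Defs.v *)
From mathcomp Require Import all_boot all_order all_algebra finmap.
From mathcomp Require Import all_classical all_reals all_analysis.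

Set Implicit Arguments.
Unset Strict Implicit.
Unset Printing Implicit Defensive.

Import Order.TTheory GRing.Theory Num.Theory.
Import numFieldNormedType.Exports.

Local Open Scope classical_set_scope.
Local Open Scope ring_scope.

Definition convex_hull (R : realType) (d : nat) (S : set 'rV[R]_d) :
    set 'rV[R]_d :=
  smallest (fun C : set 'rV[R]_d => convex_set C) S.

(* [partition] requires the blocks to be nonempty; the tolerance condition with
   [Y] empty forces this anyway. *)
Definition tolerant_partition (R : realType) (d t r : nat)
    (X : {fset 'rV[R]_d}) (A : 'I_r -> {fset 'rV[R]_d}) : Prop :=
  partition [set: 'I_r] (fun i => [set` A i]) [set` X] /\
  forall Y : {fset 'rV[R]_d}, (Y `<=` X)%fset -> (#|` Y| <= t)%N ->
    \bigcap_(i in [set: 'I_r]) convex_hull [set` (A i `\` Y)%fset] !=set0.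

Definition tolerated (R : realType) (d t r : nat) : set nat :=
  [set N | (0 < N)%N /\
    forall X : {fset 'rV[R]_d}, (N <= #|` X|)%N ->
      exists A : 'I_r -> {fset 'rV[R]_d}, tolerant_partition t X A].

(* The value is 0 if [tolerated R d t r] is empty; a true minimum is positive,
   so the default is never confused with one. *)
Definition tverberg_number (R : realType) (d t r : nat) : nat :=
  xget 0%N [set N | tolerated R d t r N /\
                    forall M, tolerated R d t r M -> (N <= M)%N].

(* Main.v *)
Require Import Defs.
From mathcomp Require Import all_boot all_order all_algebra finmap.
From mathcomp Require Import all_classical all_reals all_analysis.
From mathcomp Require Import ring lra.
Import Order.TTheory GRing.Theory Num.Theory.
Import numFieldNormedType.Exports.
Local Open Scope classical_set_scope.
Local Open Scope ring_scope.

(* Lower bound: removing a smallest block destroys a partition of fewer than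
   [r (t + 1)] points. Upper bound (random choice, after Soberon): Sarkaria's
   vectors [sarkaria x j], [j < r], sum to 0, and a coloring [c] has a Tverberg
   point as soon as 0 is in the convex hull of the vectors
   [sarkaria (x i) (c i)]. An open half-space bounded by a hyperplane through 0
   misses one of the [r] vectors of every point, so, up to an exponentially
   small probability, it misses at least about [n / r] vectors of a random
   coloring of [n] points. Polynomially many half-spaces suffice to separate 0
   from the subfamilies, so for fixed [b > r] and large [n] some coloring
   survives the removal of any [t < n / b] points. *)

Set Implicit Arguments.
Unset Strict Implicit.

(** * Convex combinations and Gordan's alternative *)

Lemma convex_combination (R : realType) (V : lmodType R) (C : set V)
    (K : eqType) (s : seq K) (w : K -> R) (p : K -> V) :
  convex_set C -> {in s, forall k, 0 <= w k} -> {in s, forall k, C (p k)} ->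
  0 < \sum_(k <- s) w k ->
  C ((\sum_(k <- s) w k)^-1 *: \sum_(k <- s) w k *: p k).
Proof.
move=> cvxC; elim: s => [|q s IHs] w0 Cp; first by rewrite big_nil ltxx.
have w0s : {in s, forall k, 0 <= w k}.
  by move=> k ks; apply: w0; rewrite inE ks orbT.
have Cps : {in s, forall k, C (p k)}.
  by move=> k ks; apply: Cp; rewrite inE ks orbT.
have wq0 : 0 <= w q by rewrite w0 ?mem_head.
have Cq : C (p q) by apply: Cp; rewrite mem_head.
have W0 : 0 <= \sum_(k <- s) w k.
  by rewrite big_seq; apply: sumr_ge0 => k /w0s.
rewrite !big_cons; set W := \sum_(k <- s) w k in W0 *.
set v := \sum_(k <- s) w k *: p k => wW0.
have [Weq|Wneq] := eqVneq W 0.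
  suff -> : v = 0.
    rewrite Weq !addr0 in wW0 *.
    by rewrite scalerA mulVf ?scale1r// gt_eqF.
  rewrite /v big_seq big1// => k ks; suff -> : w k = 0 by rewrite scale0r.
  apply/eqP; have := Weq; rewrite /W big_seq => /eqP.
  by rewrite psumr_eq0 => [/allP/(_ k ks)|//]; rewrite ks.
have Wgt : 0 < W by rewrite lt_def Wneq.
have l01 : 0 <= w q / (w q + W) <= 1.
  by rewrite divr_ge0 ?(ltW wW0)//= ler_pdivrMr// mul1r lerDl.
have := cvxC (p q) (W^-1 *: v) (Itv01 (andP l01).1 (andP l01).2).
rewrite !inE => /(_ Cq (IHs w0s Cps Wgt)); congr (C _).
rewrite /conv/= scalerDr !scalerA; congr (_ *: _ + _ *: _).
  by rewrite mulrC.
by rewrite /unstable.onem; field; rewrite Wneq gt_eqF.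
Qed.

Lemma exists_gt_seq (F : realFieldType) (l : seq F) :
  exists m, {in l, forall x, x < m}.
Proof.
elim: l => [|x l [m lm]]; first by exists 0.
exists (Num.max (x + 1) m) => y; rewrite inE lt_max => /predU1P[->|/lm->].
  by rewrite ltrDl ltr01.
by rewrite orbT.
Qed.

Lemma exists_between_seq (F : realFieldType) (l : seq F) (B : F) :
  {in l, forall x, x < B} -> exists2 m, m < B & {in l, forall x, x < m}.
Proof.
elim: l => [|x l IHl] lB; first by exists (B - 1) => //; rewrite ltrBlDr ltrDl.
have [|m mB lm] := IHl; first by move=> y yl; apply: lB; rewrite inE yl orbT.
have xB : x < B by rewrite lB ?mem_head.
exists (Num.max ((x + B) / 2) m) => [|y].
  by rewrite gt_max mB andbT midf_lt.
rewrite inE lt_max => /predU1P[->|/lm->]; first by rewrite midf_lt.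
by rewrite orbT.
Qed.

(* Gordan's alternative, by Fourier-Motzkin elimination: when [u] is positive
   on [s] but not at [q], each [p k] is combined with [p q] into a vector of
   the hyperplane [u = 0], to which the induction hypothesis applies. *)
Lemma gordan (F : realFieldType) (D : nat) (K : eqType) (s : seq K)
    (p : K -> 'rV[F]_D) : uniq s ->
  (exists u : 'cV[F]_D, {in s, forall k, 0 < (p k *m u) 0 0}) \/
  (exists w : K -> F, [/\ {in s, forall k, 0 <= w k},
     0 < \sum_(k <- s) w k & \sum_(k <- s) w k *: p k = 0]).
Proof.
elim: s p => [|q s IHs] p /=; first by left; exists 0.
move=> /andP[qs us].
have neq k : k \in s -> (k == q) = false.
  by move=> ks; apply: contraNF qs => /eqP<-.
have sumE (V : zmodType) (a : V) (f : K -> V) :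
    \sum_(k <- s) (if k == q then a else f k) = \sum_(k <- s) f k.
  by rewrite big_seq [RHS]big_seq; apply: eq_bigr => k /neq->.
have sumZE (w0 : F) (w : K -> F) :
    \sum_(k <- s) (if k == q then w0 else w k) *: p k =
    \sum_(k <- s) w k *: p k.
  by rewrite big_seq [RHS]big_seq; apply: eq_bigr => k /neq->.
have [[u up]|[w [w0 w1 wp]]] := IHs p us; last first.
  right; exists (fun k => if k == q then 0 else w k).
  rewrite !big_cons sumE sumZE eqxx scale0r !add0r; split=> // k.
  by rewrite inE => /predU1P[->|ks]; rewrite ?eqxx ?neq ?w0.
pose a := - (p q *m u) 0 0.
have aE : (p q *m u) 0 0 = - a by rewrite opprK.
have [a_lt0|a_ge0] := ltP a 0.
  left; exists u => k; rewrite inE => /predU1P[->|/up//].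
  by rewrite aE oppr_gt0.
pose p' k := a *: p k + (p k *m u) 0 0 *: p q.
have [[v vp]|[w [w0 w1 wp]]] := IHs p' us; last first.
  right; exists (fun k => if k == q then \sum_(k <- s) w k * (p k *m u) 0 0
                          else a * w k).
  have wu0 : 0 <= \sum_(k <- s) w k * (p k *m u) 0 0.
    by rewrite big_seq sumr_ge0// => k ks; rewrite mulr_ge0 ?w0 ?ltW ?up.
  split.
  - move=> k; rewrite inE => /predU1P[->|ks]; first by rewrite eqxx.
    by rewrite neq ?mulr_ge0 ?w0.
  (* [a] may be 0, so positivity has to come from the weight at [q]: since [u] is positive on [s],
     it vanishes only if every [w k] does. *)
  - rewrite big_cons eqxx sumE ltr_pwDl//; last first.
      by rewrite big_seq sumr_ge0// => k ks; rewrite mulr_ge0 ?w0.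
    rewrite lt_def wu0 andbT; apply: contraTneq w1 => /eqP.
    rewrite big_seq psumr_eq0 => [/allP z|k ks]; last first.
      by rewrite mulr_ge0 ?w0 ?ltW ?up.
    rewrite -leNgt big_seq big1// => k ks; have /implyP/(_ ks) := z k ks.
    by rewrite mulf_eq0 (gt_eqF (up k ks)) orbF => /eqP.
  - rewrite big_cons eqxx sumZE scaler_suml -big_split -[RHS]wp.
    apply: eq_bigr => k _.
    by rewrite /p' scalerDr !scalerA addrC [w k * a]mulrC.
have vpE k : 
    (p' k *m v) 0 0 = a * (p k *m v) 0 0 + (p k *m u) 0 0 * (p q *m v) 0 0.
  by rewrite /p' mulmxDl -!scalemxAl !mxE.
have combE k (b : F) :
    (p k *m (v + b *: u)) 0 0 = (p k *m v) 0 0 + b * (p k *m u) 0 0.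
  by rewrite mulmxDr -scalemxAr !mxE.
(* For [k] in [s], the value along the line [v + b *: u] is positive exactly when [b] exceeds
   [bnd k]. *)
pose bnd k := - (p k *m v) 0 0 / (p k *m u) 0 0.
have bndP (b : F) : {in [seq bnd k | k <- s], forall x, x < b} ->
    {in s, forall k, 0 < (p k *m (v + b *: u)) 0 0}.
  move=> bb k ks; have := bb (bnd k); rewrite map_f// => /(_ isT).
  by rewrite /bnd ltr_pdivrMr ?up// combE -subr_gt0 opprK addrC.
(* If [a = 0], moving along [u] leaves the value at [q] unchanged, and any [k0] in [s] shows that
   [v] is positive there. For empty [s], [p q] is either 0, hence a dependency, or positive on its
   own transpose. *)
have [a0|aN0] := eqVneq a 0.
  have [s0|[k0 k0s]] : s = [::] \/ exists k, k \in s.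
    by case: (s) => [|k s']; [left|right; exists k; rewrite mem_head].
    have [pq0|pqN0] := eqVneq (p q) 0.
      right; exists (fun=> 1); rewrite s0 !big_seq1 pq0 scaler0; split=> //.
    left; exists (p q)^T => k; rewrite s0 inE => /eqP->.
    rewrite !mxE lt_def sumr_ge0 ?andbT => [|i _]; last first.
      by rewrite mxE -expr2 sqr_ge0.
    apply: contraNneq pqN0 => /eqP.
    rewrite psumr_eq0 => [/allP z|i _]; last first.
      by rewrite mxE -expr2 sqr_ge0.
    apply/eqP/rowP => i; rewrite mxE; have := z i (mem_index_enum _).
    by rewrite mxE mulf_eq0 orbb => /eqP.
  have [b /bndP bP] := exists_gt_seq [seq bnd k | k <- s].
  left; exists (v + b *: u) => k; rewrite inE => /predU1P[->|/bP//].
  rewrite combE aE a0 oppr0 mulr0 addr0.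
  by have := vp _ k0s; rewrite vpE a0 mul0r add0r pmulr_rgt0 ?up.
have a_gt0 : 0 < a by rewrite lt_def aN0.
(* Positivity at [q] bounds [b] from above by [(p q *m v) 0 0 / a]; [vp] says that every [bnd k]
   lies strictly below this. *)
have [|b bB /bndP bP] :=
    @exists_between_seq _ [seq bnd k | k <- s] ((p q *m v) 0 0 / a).
  move=> _ /mapP[k ks ->]; rewrite /bnd ltr_pdivrMr ?up// mulrAC ltr_pdivlMr//.
  by have := vp k ks; rewrite vpE; lra.
left; exists (v + b *: u) => k; rewrite inE => /predU1P[->|/bP//].
by rewrite combE aE mulrN subr_gt0 -ltr_pdivlMr.
Qed.

(** * Basic solutions of systems of linear inequalities *)

(** [None] gives a zero row with right-hand side 0, so every choice of at most [D] tight constraints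
    is a square system and the choices form a finite type. *)
Definition tight_mx (F : realFieldType) (D : nat) (K : finType)
    (p : K -> 'rV[F]_D) (T : {ffun 'I_D -> option K}) : 'M[F]_D :=
  \matrix_i oapp p 0 (T i).

Definition tight_rhs (F : realFieldType) (D : nat) (K : finType)
    (T : {ffun 'I_D -> option K}) : 'cV[F]_D := \col_i (isSome (T i))%:R.

Definition tight_vec (F : realFieldType) (D : nat) (K : finType)
    (p : K -> 'rV[F]_D) (T : {ffun 'I_D -> option K}) : 'cV[F]_D :=
  pinvmx (tight_mx p T) *m tight_rhs F T.

(** With [B] the tight matrix and [x = c *m B], the identity [B *m pinvmx B *m B = B] turns the
    value at [tight_vec p T] into the value at any solution [v]. *)
Lemma tight_vecE (F : realFieldType) (D : nat) (K : finType)
    (p : K -> 'rV[F]_D) (T : {ffun 'I_D -> option K}) (v : 'cV[F]_D)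
    (x : 'rV[F]_D) :
  tight_mx p T *m v = tight_rhs F T -> (x <= tight_mx p T)%MS ->
  x *m tight_vec p T = x *m v.
Proof.
move=> Bv /submxP[c ->]; rewrite /tight_vec -Bv.
rewrite (mulmxA (pinvmx _)) (mulmxA (_ *m _) (pinvmx _ *m _)).
by rewrite (mulmxA (_ *m _) (pinvmx _)) mulmxKpV ?submxMl.
Qed.

(** Slide [v] along a direction [w] that preserves the tight constraints and decreases the value at
    [k1], until a first constraint [k2] becomes tight. As [w] kills the old rows but not [p k2], the
    rank grows. *)
Lemma tight_grow (F : realFieldType) (D : nat) (K : finType)
    (p : K -> 'rV[F]_D) (S : {set K}) (T : {ffun 'I_D -> option K})
    (v : 'cV[F]_D) (m : 'I_D) (k1 : K) :
  {in S, forall k, 1 <= (p k *m v) 0 0} ->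
  tight_mx p T *m v = tight_rhs F T -> T m = None ->
  k1 \in S -> ~~ (p k1 <= tight_mx p T)%MS ->
  exists k2 v', let T' := [ffun i => if i == m then Some k2 else T i] in
    [/\ {in S, forall k, 1 <= (p k *m v') 0 0},
      tight_mx p T' *m v' = tight_rhs F T' &
      (\rank (tight_mx p T) < \rank (tight_mx p T'))%N].
Proof.
set B := tight_mx p T => v1 Bv Tm k1S k1B.
have [w Bw k1w] : exists2 w : 'cV[F]_D, B *m w = 0 & (p k1 *m w) 0 0 < 0.
  move: k1B; rewrite submxE => /rV0Pn[j yj].
  have sE (a : F) (z : 'M[F]_1) : (a *: z) 0 0 = a * z 0 0 by rewrite mxE.
  have cE (z : 'rV[F]_D) : (col j z) 0 0 = z 0 j by rewrite mxE.
  pose w : 'cV_D := cokermx B *m delta_mx j 0.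
  (* This factor makes the value at [k1] minus a nonzero square. *)
  exists (- (p k1 *m cokermx B) 0 j *: w).
    by rewrite -scalemxAr (mulmxA B (cokermx B)) mulmx_coker mul0mx scaler0.
  rewrite -scalemxAr (mulmxA (p k1) (cokermx B)) -colE sE cE mulNr oppr_lt0.
  rewrite -expr2.
  by rewrite exprn_even_gt0.
have k1P : (k1 \in S) && ((p k1 *m w) 0 0 < 0) by rewrite k1S.
(* The step length at which constraint [k] becomes tight; the minimal one keeps all the others
   satisfied. *)
pose gain k := ((p k *m v) 0 0 - 1) / - (p k *m w) 0 0.
case: (@arg_minP _ F K k1
  (fun k => (k \in S) && ((p k *m w) 0 0 < 0)) gain k1P).
move=> k2 /andP[k2S k2w] k2min.
pose v' := v + gain k2 *: w.
have v'E k : (p k *m v') 0 0 = (p k *m v) 0 0 + gain k2 * (p k *m w) 0 0.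
  by rewrite mulmxDr -scalemxAr !mxE.
have gain0 : 0 <= gain k2.
  by rewrite divr_ge0 ?subr_ge0 ?v1// oppr_ge0 ltW.
have Nk2B : ~~ (p k2 <= B)%MS.
  apply: contraTN k2w => /submxP[c ->].
  by rewrite -mulmxA Bw mulmx0 mxE ltxx.
exists k2, v'; set T' := [ffun i => _] => /=; set B' := tight_mx p T'.
have rowB' i : row i B' = if i == m then p k2 else row i B.
  by rewrite rowK ffunE; case: ifP => // _; rewrite rowK.
split.
- move=> k kS; rewrite v'E; have [kw|kw] := leP 0 ((p k *m w) 0 0).
    by rewrite (le_trans (v1 k kS))// lerDl mulr_ge0.
  have := k2min k; rewrite kS kw => /(_ isT).
  by rewrite [gain k]/gain ler_pdivlMr ?oppr_gt0//; lra.
- apply/row_matrixP => i; rewrite row_mul rowB'.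
  have [->|im] := eqVneq i m.
    apply/rowP => j; rewrite ord1 v'E [RHS]mxE [RHS]mxE ffunE eqxx /gain/=.
    by field; rewrite lt_eqF.
  rewrite /v' mulmxDr -scalemxAr -!row_mul Bw Bv raddf0 scaler0 addr0.
  by apply/rowP => j; rewrite !mxE ffunE (negbTE im).
- apply: rank_ltmx; rewrite /ltmx; apply/andP; split.
    apply/row_subP => i; have [->|im] := eqVneq i m.
      by rewrite rowK Tm sub0mx.
    by have := row_sub i B'; rewrite rowB' (negbTE im).
  apply: contra Nk2B; apply: submx_trans.
  by have := row_sub m B'; rewrite rowB' eqxx.
Qed.

(* A feasible system [p k *m v >= 1] has a solution pinned down by at most [D]
   tight constraints spanning all of its rows. Only [(#|K| + 1) ^ D] vectors
   [tight_vec p T] are therefore needed to separate the subsets of [p]. *)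
Lemma basic_solution (F : realFieldType) (D : nat) (K : finType)
    (p : K -> 'rV[F]_D) (S : {set K}) (u : 'cV[F]_D) :
  {in S, forall k, 1 <= (p k *m u) 0 0} ->
  exists T, {in S, forall k, 0 < (p k *m tight_vec p T) 0 0}.
Proof.
move=> u1; pose TT := {ffun 'I_D -> option K}.
pose B (T : TT) := tight_mx p T; pose b (T : TT) := tight_rhs F T.
have spanned T v : {in S, forall k, 1 <= (p k *m v) 0 0} -> B T *m v = b T ->
    {in S, forall k, (p k <= B T)%MS} ->
    exists T, {in S, forall k, 0 < (p k *m tight_vec p T) 0 0}.
  move=> v1 Bv pB; exists T => k kS.
  by rewrite (tight_vecE Bv) ?pB// (lt_le_trans ltr01)// v1.
(* One tight constraint is added per round: after [m] rounds the rank is at least [m] and the slots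
   from [m] on are free, unless the chosen rows already span those of [S]. Rank [D] spans
   everything. *)
suff grow m : (m <= D)%N ->
    (exists T, {in S, forall k, 0 < (p k *m tight_vec p T) 0 0}) \/
    (exists T v, [/\ {in S, forall k, 1 <= (p k *m v) 0 0}, B T *m v = b T,
      (m <= \rank (B T))%N & forall i : 'I_D, (m <= i)%N -> T i = None]).
  have [//|[T [v [v1 Bv rkB _]]]] := grow D (leqnn D).
  apply: (spanned T v) => // k _; apply: submx_full.
  by rewrite /row_full eqn_leq rank_leq_col.
elim: m => [|m IHm] mD.
  right; exists [ffun=> None], u; split=> //; last by move=> i _; rewrite ffunE.
  have -> : B [ffun=> None] = 0.
    by apply/row_matrixP => i; rewrite rowK ffunE raddf0.
  by rewrite mul0mx; apply/colP => i; rewrite !mxE ffunE.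
have [|[T [v [v1 Bv rkB TN]]]] := IHm (ltnW mD); first by left.
have [/forall_inP pB|] := boolP [forall k in S, (p k <= B T)%MS].
  by left; apply: (spanned T v).
rewrite negb_forall => /existsP[k1]; rewrite negb_imply => /andP[k1S k1B].
have [k2 [v' /= [v'1 Bv' rk']]] :=
  tight_grow v1 Bv (TN (Ordinal mD) (leqnn m)) k1S k1B.
right; eexists _, v'; split; [exact: v'1|exact: Bv'| |].
  exact: leq_trans rk'.
move=> i mi; have Ti : T i = None by apply: TN; apply: ltnW.
have im : (i == Ordinal mD) = false.
  by apply/negbTE; apply: contraTneq mi => ->; rewrite /= ltnn.
by rewrite ffunE im.
Qed.

(** * Sarkaria's tensor construction *)

(* The tensor product of [(x, 1)] with [e_j - (1/r, ..., 1/r)], flattened. *)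
Definition sarkaria (F : realFieldType) (d r : nat) (x : 'rV[F]_d) (j : 'I_r) :
    'rV[F]_((d + 1) * r) :=
  mxvec ((row_mx x (1 : 'M[F]_1))^T *m (delta_mx 0 j - const_mx r%:R^-1)).

Lemma sum_sarkaria (F : realFieldType) (d r : nat) (x : 'rV[F]_d) :
  (0 < r)%N -> \sum_(j < r) sarkaria x j = 0.
Proof.
move=> r0; rewrite -linear_sum -mulmx_sumr.
rewrite [X in _ *m X](_ : _ = 0) ?mulmx0 ?linear0//.
apply/rowP => l; rewrite summxE mxE.
under eq_bigr do rewrite !mxE eqxx /=.
rewrite big_split/= sumr_const card_ord -[X in _ + X]mulr_natr mulNr.
rewrite mulVf ?pnatr_eq0 -?lt0n//.
rewrite (bigD1 l)//= eqxx big1 ?addr0 ?subrr// => j jl.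
by rewrite eq_sym (negbTE jl).
Qed.

(** Coordinate [(a, j)] of the vanishing sum says that color [j] carries exactly [1 / r] of the
    total of the [w k *: h k]. The last coordinate of [h] gives the weights, the others the
    points. *)
Lemma sarkaria_blocks (F : realFieldType) (d r : nat) (K : eqType) (s : seq K)
    (w : K -> F) (x : K -> 'rV[F]_d) (c : K -> 'I_r) (j : 'I_r) :
  \sum_(k <- s) w k *: sarkaria (x k) (c k) = 0 ->
  \sum_(k <- s | c k == j) w k = r%:R^-1 * \sum_(k <- s) w k /\
  \sum_(k <- s | c k == j) w k *: x k = r%:R^-1 *: \sum_(k <- s) w k *: x k.
Proof.
pose h k := row_mx (x k) (1 : 'M[F]_1).
move=> s0; have hE : \sum_(k <- s | c k == j) w k *: h k =
                     r%:R^-1 *: \sum_(k <- s) w k *: h k.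
  move/(congr1 vec_mx): s0; rewrite linear_sum linear0 => /matrixP s0.
  apply/rowP => a; have := s0 a j; rewrite [RHS]mxE summxE => aj.
  apply/eqP; rewrite -subr_eq0 -[X in _ == X]aj; apply/eqP.
  rewrite summxE mxE summxE mulr_sumr big_mkcond -sumrB/=.
  apply: eq_bigr => k _.
  rewrite /sarkaria -/(h k) [vec_mx _]linearZ/= mxvecK.
  move: (h k) => hk; rewrite !mxE big_ord1 !mxE eqxx/= eq_sym.
  by case: eqP => _; rewrite ?mxE /=; ring.
split.
- move/(congr1 rsubmx): hE; rewrite linearZ !linear_sum/=.
  under eq_bigr do rewrite linearZ/= row_mxKr.
  under [in RHS]eq_bigr do rewrite linearZ/= row_mxKr.
  rewrite -!scaler_suml scalerA => /matrixP/(_ 0 0).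
  by rewrite !mxE !mulr1.
- move/(congr1 lsubmx): hE; rewrite linearZ !linear_sum/=.
  under eq_bigr do rewrite linearZ/= row_mxKl.
  under [in RHS]eq_bigr do rewrite linearZ/= row_mxKl.
  by move=> ->; rewrite scaler_sumr.
Qed.

Lemma tverberg_or_separated (R : realType) (d r : nat) (K : eqType) (s : seq K)
    (x : K -> 'rV[R]_d) (c : K -> 'I_r) : (0 < r)%N -> uniq s ->
  (exists y, forall j,
     convex_hull [set x k | k in [set k | k \in s /\ c k = j]] y) \/
  (exists u : 'cV[R]_((d + 1) * r),
     {in s, forall k, 0 < (sarkaria (x k) (c k) *m u) 0 0}).
Proof.
move=> r0 us.
have [?|[w [w0 W0 wp]]] := gordan (fun k => sarkaria (x k) (c k)) us.
  by right.
(* The global weighted mean is also the weighted mean of each color class, the factors [1 / r]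
   cancelling. *)
left; exists ((\sum_(k <- s) w k)^-1 *: \sum_(k <- s) w k *: x k) => j.
have [wj xj] := sarkaria_blocks j wp.
have rN0 : r%:R != 0 :> R by rewrite pnatr_eq0 -lt0n.
move=> C [cvxC xC].
have := @convex_combination _ _ C _ [seq k <- s | c k == j] w x cvxC.
rewrite !big_filter wj xj scalerA invfM invrK mulrAC mulfV// mul1r; apply.
- by move=> k; rewrite mem_filter => /andP[_ /w0].
- move=> k; rewrite mem_filter => /andP[/eqP ckj ks].
  by apply: xC; exists k.
- by rewrite mulr_gt0// invr_gt0 ltr0n.
Qed.

(** * Random colorings and the exponential estimate *)

(* The first moment method with exponential weights: under a uniformly random
   [c], the number of [i] with [G m i (c i)] dominates a binomial variable of
   parameters [#|I|] and [1 / r]. *)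
Lemma exists_hitting_coloring (F : realFieldType) (I M : finType) (r t : nat)
    (lam : F) (G : M -> I -> pred 'I_r) :
  0 < lam < 1 -> (forall m i, exists j, G m i j) ->
  #|M|%:R * (r%:R - 1 + lam) ^+ #|I| < lam ^+ t * r%:R ^+ #|I| ->
  exists c : {ffun I -> 'I_r}, forall m, (t < #|[set i | G m i (c i)]%SET|)%N.
Proof.
move=> /andP[lam0 lam1] Gex; apply: contraPP => /forallNP noc.
apply/negP; rewrite -leNgt.
have cE : r%:R ^+ #|I| = \sum_(c : {ffun I -> 'I_r}) (1 : F).
  by rewrite sumr_const card_ffun card_ord natrX.
rewrite cE mulr_sumr.
(* Each [c] has by assumption an [m] with at most [t] hits, whose weight is at least [lam ^+ t]. *)
apply: (@le_trans _ _ (\sum_(c : {ffun I -> 'I_r}) \sum_(m : M)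
          \prod_i lam ^+ G m i (c i))).
  apply: ler_sum => c _; have /existsNP[m /negP] := noc c.
  rewrite -leqNgt mulr1 => hits.
  rewrite (bigD1 m)//= ler_wpDr//.
    rewrite sumr_ge0// => m' _; rewrite prodr_ge0// => i _.
    by rewrite exprn_ge0// ltW.
  rewrite -expr_sum; apply: ler_wiXn2l; rewrite ?ltW//.
  apply: leq_trans hits.
  rewrite -sum1dep_card [leqRHS]big_mkcond; apply: leq_sum => i _.
  by case: (G m i _).
(* For fixed [m] the sum over colorings factors over the points; each factor is at most
   [r - 1 + lam], at least one color being a hit. *)
rewrite exchange_big/= -sum1_card natr_sum mulr_suml; apply: ler_sum => m _.
rewrite mul1r -(bigA_distr_bigA (fun i j => lam ^+ G m i j)) -prodr_const/=.
apply: ler_prod => i _; rewrite sumr_ge0 => [|j _]; last first.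
  by rewrite exprn_ge0// ltW.
have [j Gj] := Gex m i; rewrite (bigD1 j)//= Gj expr1 addrC lerD2r.
apply: (@le_trans _ _ (\sum_(k < r | k != j) 1)).
  by apply: ler_sum => k _; case: (G m i k); rewrite ?expr1 ?expr0// ltW.
rewrite sumr_const cardC1 card_ord -subn1 natrB//.
exact: leq_ltn_trans (ltn_ord j).
Qed.

(** For large [n] the square bound [(e * n) ^ 2 <= exp (2 * e * n)] dominates [n * r + 1]. Splitting
    [a] into [D.+1] shares, not [D], leaves one share over for strictness. *)
Lemma poly_lt_expR (R : realType) (D r : nat) (a : R) : 0 < a ->
  exists n0, forall n, (n0 <= n)%N -> ((n * r).+1 ^ D)%:R < expR (a * n%:R).
Proof.
move=> a0; pose e := a / D.+1%:R / 2.
have e0 : 0 < e by rewrite !divr_gt0.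
exists (Num.bound (r.+1%:R / e ^+ 2)).+1 => n n0n.
have n0 : (0 < n)%N by apply: leq_trans n0n.
have base : (n * r).+1%:R <= expR (a / D.+1%:R * n%:R).
  have -> : a / D.+1%:R * n%:R = e * n%:R + e * n%:R by rewrite -mulrDl -splitr.
  rewrite expRD -expr2; apply: (@le_trans _ _ ((e * n%:R) ^+ 2)); last first.
    have en0 : 0 <= e * n%:R by exact: mulr_ge0 (ltW e0) (ler0n _ _).
    rewrite lerXn2r ?nnegrE ?expR_ge0//.
    by apply: le_trans _ (expR_ge1Dx _); rewrite lerDr.
  apply: (@le_trans _ _ (n%:R * r.+1%:R)).
    by rewrite -natrM ler_nat mulnS -add1n leq_add2r.
  have -> : (e * n%:R) ^+ 2 = n%:R * (n%:R * e ^+ 2) by ring.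
  rewrite ler_wpM2l//.
  rewrite mulrC -ler_pdivrMl ?exprn_gt0// mulrC.
  apply: ltW; apply: (lt_le_trans (archi_boundP _)).
    by rewrite divr_ge0 ?exprn_ge0// ltW.
  by rewrite ler_nat ltnW.
rewrite natrX; apply: (@le_lt_trans _ _ (expR (a / D.+1%:R * n%:R) ^+ D)).
  by rewrite lerXn2r ?nnegrE ?expR_ge0.
rewrite -expRM_natl ltr_expR mulrA ltr_pM2r ?ltr0n//.
rewrite mulrCA gtr_pMr// ltr_pdivrMr ?ltr0n// mul1r ltr_nat.
by [].
Qed.

Lemma union_bound (R : realType) (D r : nat) (b : R) : (0 < r)%N -> r%:R < b ->
  exists2 lam : R, 0 < lam < 1 & exists n0, forall n t, (n0 <= n)%N ->
    b * t%:R < n%:R ->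
    ((n * r).+1 ^ D)%:R * (r%:R - 1 + lam) ^+ n < lam ^+ t * r%:R ^+ n.
Proof.
move=> r0 rb; have r0' : 0 < r%:R :> R by rewrite ltr0n.
have b0 : 0 < b by rewrite (lt_trans r0').
pose eta := (b / r%:R - 1) / 2.
have eta0 : 0 < eta by rewrite divr_gt0// subr_gt0 ltr_pdivlMr// mul1r.
have etab : (1 + eta) * r%:R < b.
  by rewrite -ltr_pdivlMr// /eta; move: eta0; rewrite /eta; lra.
pose lam := expR (- eta).
(* Per point, the factor [(r - 1 + lam) / r] gains [(1 - lam) / r] in the exponent, while [lam ^+ t]
   costs at most [eta / b] because [t < n / b]. The surplus [a] beats the polynomial; it is positive
   by [1 - exp (- eta) >= eta / (1 + eta)] and [etab]. *)
pose a := (1 - lam) / r%:R - eta / b.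
have a0 : 0 < a.
  rewrite subr_gt0; apply: (@lt_le_trans _ _ (eta / (1 + eta) / r%:R)).
    by rewrite -mulrA -invfM ltr_pM2l// ltf_pV2 ?posrE// mulr_gt0// addr_gt0.
  rewrite ler_pM2r ?invr_gt0//.
  have -> : eta / (1 + eta) = 1 - (1 + eta)^-1.
    by field; rewrite gt_eqF// addr_gt0.
  rewrite lerD2l lerN2 /lam expRN lef_pV2 ?posrE ?expR_gt0 ?addr_gt0//.
  exact: expR_ge1Dx.
exists lam; first by rewrite expR_gt0 expR_lt1 oppr_lt0.
have [n0 n0P] := poly_lt_expR D r a0.
exists n0 => n t n0n btn.
have lamr : r%:R - 1 + lam <= r%:R * expR (- ((1 - lam) / r%:R)).
  have -> : r%:R - 1 + lam = r%:R * (1 + - ((1 - lam) / r%:R)).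
    by field; rewrite gt_eqF.
  by rewrite ler_pM2l// expR_ge1Dx.
have lam0 : 0 <= r%:R - 1 + lam.
  by rewrite addr_ge0 ?expR_ge0// subr_ge0 ler1n.
apply: (@le_lt_trans _ _ (((n * r).+1 ^ D)%:R *
          (r%:R * expR (- ((1 - lam) / r%:R))) ^+ n)).
  by rewrite ler_wpM2l ?ler0n// lerXn2r ?nnegrE// mulr_ge0 ?expR_ge0// ltW.
rewrite exprMn mulrCA [ltRHS]mulrC ltr_pM2l ?exprn_gt0//.
rewrite -expRM_natl -expRM_natl.
apply: (@lt_le_trans _ _
  (expR (a * n%:R) * expR (n%:R * - ((1 - lam) / r%:R)))).
  by rewrite ltr_pM2r ?expR_gt0// n0P.
rewrite -expRD ler_expR.
have : t%:R * eta <= eta / b * n%:R.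
  rewrite mulrC -mulrA ler_pM2l// mulrC ler_pdivlMr// mulrC ltW//.
rewrite /a; set q := (1 - lam) / r%:R; lra.
Qed.

Lemma exists_tolerant_coloring (R : realType) (d r : nat) (b : R) :
  (0 < r)%N -> r%:R < b ->
  exists n0, forall (I : finType) (x : I -> 'rV[R]_d) (t : nat),
    (n0 <= #|I|)%N -> b * t%:R < #|I|%:R ->
    exists c : {ffun I -> 'I_r}, forall Z : {set I}, (#|Z| <= t)%N ->
      exists y, forall j,
        convex_hull [set x i | i in [set i | i \notin Z /\ c i = j]] y.
Proof.
move=> r0 rb; pose D := ((d + 1) * r)%N.
have [lam lam01 [n0 n0P]] := union_bound D r0 rb.
exists n0 => I x t n0I btI.
pose p (k : I * 'I_r) := sarkaria (x k.1) k.2.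
(* A hit is a vector outside the open half-space of [tight_vec p T]. The [r] vectors of a point sum
   to 0, so one of them is a hit. *)
pose G (T : {ffun 'I_D -> option (I * 'I_r)}) i : pred 'I_r :=
  fun j => ~~ (0 < (p (i, j) *m tight_vec p T) 0 0).
have Gex T i : exists j, G T i j.
  apply/existsP; rewrite -negb_forall; apply/negP => /forallP allpos.
  have : 0 < \sum_(j < r) (p (i, j) *m tight_vec p T) 0 0.
    rewrite (bigD1 (Ordinal r0))//= ltr_pwDl ?allpos// sumr_ge0// => j _.
    exact/ltW/allpos.
  rewrite -summxE -mulmx_suml [X in X *m _](sum_sarkaria (x i) r0).
  by rewrite mul0mx mxE ltxx.
have cardT : #|{: {ffun 'I_D -> option (I * 'I_r)}}| = ((#|I| * r).+1 ^ D)%N.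
  by rewrite card_ffun card_option card_prod !card_ord.
have [|c cP] := @exists_hitting_coloring R I _ r t lam G lam01 Gex.
  by rewrite cardT; apply: n0P.
exists c => Z Zt.
have [[y yP]|[u uP]] :=
  @tverberg_or_separated R d r _ (enum (~: Z)%SET) x c r0 (enum_uniq _).
  exists y => j C [cvxC xC]; apply: (yP j); split=> // z [i [iZ ij] <-].
  apply: xC; exists i => //; split=> //.
  by move: iZ; rewrite mem_enum inE.
pose S := [set k : I * 'I_r | (k.1 \notin Z) && (c k.1 == k.2)]%SET.
have uS : {in S, forall k, 0 < (p k *m u) 0 0}.
  move=> [i j]; rewrite inE => /andP[/= iZ /eqP <-].
  by apply: uP; rewrite mem_enum inE.
(* Scaling by [m] lifts the positive values of [u] on [S] to at least 1. *)
have [m mP] := exists_gt_seq [seq ((p k *m u) 0 0)^-1 | k <- enum S].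
have [|T TP] := @basic_solution _ _ _ p S (m *: u).
  move=> k kS; rewrite -scalemxAr mxE -ler_pdivrMr ?uS// mul1r ltW//.
  by apply: mP; apply/mapP; exists k; rewrite ?mem_enum.
(* Surviving vectors are positive at [tight_vec p T], so the more than [t] hits would all lie in
   [Z]. *)
have := cP T; rewrite ltnNge => /negP[]; apply: leq_trans Zt.
apply/subset_leq_card/fintype.subsetP => i; rewrite inE; apply: contraR => iZ.
by apply: TP; rewrite inE /= iZ eqxx.
Qed.

(** * Lower and upper bounds for tolerated sizes *)

Lemma convex_hull_set0 (R : realType) (d : nat) :
  convex_hull (set0 : set 'rV[R]_d) = set0.
Proof. by apply: smallest_id => x y l; rewrite inE. Qed.

Lemma sum_card_partition_le (T : choiceType) (r : nat) (X : {fset T})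
    (A : 'I_r -> {fset T}) :
  partition [set: 'I_r] (fun i => [set` A i]) [set` X] ->
  (\sum_(j < r) #|` A j| <= #|` X|)%N.
Proof.
move=> [coverA trivA _].
apply: (@leq_trans (\sum_(j < r) \sum_(x <- X) (x \in A j))%N).
  apply: leq_sum => j _.
  have -> : (\sum_(x <- X) (x \in A j) = size [seq x <- X | x \in A j])%N.
    rewrite size_filter -sum1_count [RHS]big_mkcond/=.
    by apply: eq_bigr => x _; case: (x \in A j).
  apply: uniq_leq_size => [|x xj]; first exact: fset_uniq.
  rewrite mem_filter xj /=; suff : [set` X] x by [].
  by rewrite -coverA; exists j.
rewrite exchange_big/= -sum1_size; apply: leq_sum => x _.
have [[j xj]|noj] := pselect (exists j, x \in A j).
  rewrite (bigD1 j)//= xj big1// => k kj; case: (boolP (x \in A k)) => // xk.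
  by move/eqP: kj; case; apply: trivA => //; exists x.
rewrite big1// => j _; case: (boolP (x \in A j)) => // xj.
by case: noj; exists j.
Qed.

Lemma tolerated_ge (R : realType) (d t r N : nat) :
  (0 < d)%N -> tolerated R d t r N -> (r * t.+1 <= N)%N.
Proof.
move=> d0 [_ tolN].
(* Diagonal points, distinct because [d > 0]. *)
pose X := [fset (const_mx (nat_of_ord i)%:R : 'rV[R]_d) | i in 'I_N]%fset.
have cardX : #|` X| = N.
  rewrite card_imfset/= ?size_enum_ord//; last first.
  move=> i j /rowP/(_ (Ordinal d0)); rewrite !mxE => /eqP.
  by rewrite eqr_nat => /eqP/val_inj.
have [|A [partA tolA]] := tolN X; first by rewrite cardX.
rewrite -[leqRHS]cardX; apply: leq_trans (sum_card_partition_le partA).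
rewrite -[X in (X * _)%N]card_ord -sum_nat_const; apply: leq_sum => j _.
rewrite ltnNge; apply/negP => Ajt.
have AX : (A j `<=` X)%fset.
  apply/fsubsetP => x xj; suff : [set` X] x by [].
  by case: partA => <- _ _; exists j.
have [y /(_ j I)] := tolA _ AX Ajt.
by rewrite fsetDv set_fset0 convex_hull_set0.
Qed.

Lemma eventually_tolerated (R : realType) (d r : nat) (b : R) :
  (0 < r)%N -> r%:R < b ->
  exists n0, forall t N, (n0 <= N)%N -> b * t%:R < N%:R -> tolerated R d t r N.
Proof.
move=> r0 rb; have b0 : 0 < b by apply: lt_trans rb; rewrite ltr0n.
have [n0 n0P] := exists_tolerant_coloring d r0 rb.
exists n0 => t N n0N btN; split.
  by rewrite -(ltr0n R) (le_lt_trans _ btN)// mulr_ge0// ltW.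
move=> X NX.
have [||c cP] := n0P X val t.
- by rewrite -cardfE (leq_trans n0N).
- by rewrite -cardfE (lt_le_trans btN)// ler_nat.
pose A j := [fset val i | i in [set i : X | c i == j]%SET]%fset.
have AP x j : reflect (exists2 i : X, c i = j & x = val i) (x \in A j).
  apply: (iffP (imfsetP _ _ _ _)) => /= -[i ij ->]; exists i => //.
    by apply/eqP; move: ij; rewrite inE.
  by rewrite inE ij.
have tolA (Y : {fset 'rV[R]_d}) : (#|` Y| <= t)%N ->
    \bigcap_(j in [set: 'I_r]) convex_hull [set` (A j `\` Y)%fset] !=set0.
  move=> Yt; pose Z := [set i : X | val i \in Y]%SET.
  have [|y yP] := cP Z.
    apply: leq_trans Yt.
    have -> : #|Z| = #|` [fset val i | i in Z]%fset|.
      by rewrite card_imfset/= ?cardE//; exact: val_inj.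
    apply/fsubset_leq_card/fsubsetP => _ /imfsetP[i /= iZ ->].
    by move: iZ; rewrite inE.
  exists y => j _ C [cvxC AC]; apply: (yP j); split=> // _ [i [iZ ij] <-].
  apply: AC; rewrite /= inE; apply/andP; split.
    by move: iZ; rewrite inE.
  by apply/AP; exists i.
exists A; split; last by move=> Y _; apply: tolA.
split.
- apply/seteqP; split=> [x [j _ /AP[i _ ->]]|x /= xX]; first exact: valP.
  by exists (c [` xX]%fset) => //; apply/AP; exists [` xX]%fset.
- move=> j k _ _ [x [/AP[i <- xi] /AP[i' <-]]].
  by rewrite xi => /val_inj->.
- move=> j _; have [|y /(_ j Logic.I)] := tolA fset0; first by rewrite cardfs0.
  rewrite fsetD0; have [->|/set0P//] := eqVneq [set` A j] set0.
  by rewrite convex_hull_set0.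
Qed.

(** * The minimum and its asymptotics *)

(** One tolerated [N] guarantees a least one, so [xget] does not return its default 0. *)
Lemma tverberg_number_le (R : realType) (d t r N : nat) :
  tolerated R d t r N ->
  tolerated R d t r (tverberg_number R d t r) /\
  (tverberg_number R d t r <= N)%N.
Proof.
move=> tolN; have exT : exists n, `[< tolerated R d t r n >].
  by exists N; apply/asboolP.
have [] : [set N | tolerated R d t r N /\
    forall M, tolerated R d t r M -> (N <= M)%N] (tverberg_number R d t r).
  apply: xgetPex; case: (ex_minnP exT) => m /asboolP tolm mmin.
  by exists m; split=> // M tolM; apply: mmin; apply/asboolP.
by move=> tolT /(_ N tolN).
Qed.

Theorem theorem1p1 (R : realType) (r d : nat) (r_gt0 : (0 < r)%N)
    (d_gt0 : (0 < d)%N) :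
  (fun t : nat =>
     ((tverberg_number R d t r)%:R - r%:R * t%:R) / t%:R : R) @ \oo --> (0 : R).
Proof.
apply/cvgrPdist_le => eps eps0.
(* Half of [eps] is the slack above [r]; the other half absorbs the [+ 1] of rounding, since
   [2 / eps < t]. *)
have rb : r%:R < r%:R + eps / 2 by rewrite ltrDl divr_gt0.
have [n0 n0P] := eventually_tolerated d r_gt0 rb.
exists (maxn n0 (Num.bound (2 / eps))) => // t /=.
rewrite geq_max => /andP[n0t et].
have te : 2 / eps < t%:R.
  apply: (lt_le_trans (archi_boundP _)); first by rewrite divr_ge0// ltW.
  by rewrite ler_nat.
have t0 : 0 < t%:R :> R by apply: le_lt_trans te; rewrite divr_ge0// ltW.
pose x := (r%:R + eps / 2) * t%:R; pose N := (Num.truncn x).+1.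
have r1 : 1 <= r%:R :> R by rewrite ler1n.
have x0 : 0 <= x by rewrite mulr_ge0 ?(ltW t0)// addr_ge0// divr_ge0// ltW.
have /andP[Nx xN] := truncn_itv x0.
have tx : t%:R <= x.
  by rewrite -[leLHS]mul1r ler_wpM2r ?(ltW t0)// (le_trans r1)// ltW.
have [|tolT TN] := tverberg_number_le (n0P t N _ xN).
  rewrite -(ler_nat R) (le_trans _ (ltW xN))// (le_trans _ tx)//.
  by rewrite ler_nat.
have lower : r%:R * t%:R <= (tverberg_number R d t r)%:R :> R.
  rewrite -natrM ler_nat (leq_trans _ (tolerated_ge d_gt0 tolT))//.
  by rewrite leq_mul2l leqnSn orbT.
have upper : (tverberg_number R d t r)%:R <= x + 1.
  apply: (@le_trans _ _ N%:R); first by rewrite ler_nat.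
  by rewrite -natr1 lerD2r.
rewrite sub0r normrN ger0_norm; last by rewrite divr_ge0 ?subr_ge0// ltW.
rewrite ler_pdivrMr//.
move: te; rewrite ltr_pdivrMr// => te.
by move: upper; rewrite /x; lra.
Qed.
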